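(* Let $\kappa\in\mathbb N$, let $\mathfrak p$ satisfy the kernel assumptions (K1)--(K6) of the context, let $G\in C_c^{1,\infty}(\mathbb R_+\times\mathbb R)$ and let $T>0$ be such that the support of $G$ is contained in $[0,T)\times\mathbb R$. Let $H_t(u,v)=\mathfrak p(u,v)[G_t(v)-G_t(u)]$ and $H^N_{t,x,y}=H_t(\frac xN,\frac yN)$. Let $(\mathbb P_N)_{N\ge1}$ be probability measures on $\mathbb D(\mathbb R_+;\mathbb N_0^{\mathbb Z})$, with expectations $\mathbb E_N$, such that for every $T'>0$ $$\limsup_{N\to\infty}\ \sup_{x\in\mathbb Z}\ \mathbb E_N\Big[\int_0^{T'}|\eta_t(x)|^2\,dt\Big]<\infty .$$ Then for any $R>0$ and $\epsilon'>0$, $$\limsup_{\epsilon\downarrow0}\limsup_{N\to\infty}\mathbb E_N\Bigg[\frac1{N^2}\int_0^T\Bigg|\sum_{(x,y)\in NA_{R,\epsilon'}}H^N_{t,x,y}\Big(\eta_t(x)\big(\kappa-\eta_t(y)\big)-\eta_t(x)^{\epsilon N}\big(\kappa-\eta_t(y)^{\epsilon N}\big)\Big)\Bigg|\,dt\Bigg]=0 .$$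
   Context: $\mathbb N=\{1,2,\dots\}$, $\mathbb N_0=\mathbb N\cup\{0\}$, $\mathbb R_+=[0,\infty)$, $\mathbb R_0^2=\{(u,v)\in\mathbb R^2:u\ne v\}$. $\mathbb D(\mathbb R_+;E)$: càdlàg paths with the Skorokhod topology; $(\eta_t)_{t\ge 0}$ is the canonical process. $C_c^{1,\infty}(\mathbb R_+\times\mathbb R)$: continuous functions compactly supported in space and time, continuously differentiable in time and smooth in space; $G_t=G(t,\cdot)$. Kernel assumptions. $\mathfrak p:\mathbb R_0^2\to[0,\infty)$, with the convention $\mathfrak p(u,u)=0$, and $\mathfrak s(u,v):=\tfrac12(\mathfrak p(u,v)+\mathfrak p(v,u))$. (K1) $\mathfrak p$ is Lipschitz continuous on every compact subset of $\mathbb R_0^2$. (K2) There is $\gamma>0$ with $\mathfrak p(\lambda u,\lambda v)=\lambda^{-(1+\gamma)}\mathfrak p(u,v)$ for all $(u,v)\in\mathbb R^2_0$, $\lambda>0$. (K3) For every compact $K\subset\mathbb R$, $\int_K\int_{\mathbb R}\mathfrak s(u,v)\min\{|u-v|,1\}\,dv\,du<\infty$. (K4) $\sup_{x\in\mathbb Z}\sum_{y\in\mathbb Z,\,y\ne x}\mathfrak s(x,y)<\infty$. (K5) For every $R>0$, $\limsup_{\epsilon\downarrow0}\limsup_{N\to\infty}\frac{N^\gamma}{N^2}\sum_{|x|<RN}\sum_{|y-x|\le\epsilon N}\mathfrak s(x,y)|x-y|=0$. (K6) For every $R>0$, $\limsup_{m\to\infty}\limsup_{N\to\infty}\frac{N^\gamma}{N}\sum_{|x|<RN}\sum_{|y|\ge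 mN}\mathfrak s(x,y)=0$. (Sums over integers $x,y$.) Sets and averages. $A_R=\mathbb R^2\setminus\{(u,v):|u|\ge R\text{ and }|v|\ge R\}$, $A_{R,\epsilon'}=\{(u,v)\in A_R:\epsilon'<|u-v|<(\epsilon')^{-1}\}$; sums over $(x,y)\in NA$ mean sums over $(x,y)\in\mathbb Z^2$ with $(x/N,y/N)\in A$. Block average: $\eta(x)^{\ell}=\frac1{2\ell+1}\sum_{z\in\mathbb Z,|z|\le\ell}\eta(x+z)$, and $\eta(x)^{\epsilon N}$ means $\ell=\lfloor\epsilon N\rfloor$. *)

(* Defs.v *)
From HB Require Import structures.
From mathcomp Require Import all_boot all_order all_algebra.
From mathcomp Require Import all_classical all_reals all_analysis.

Set Implicit Arguments.
Unset Strict Implicit.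
Unset Printing Implicit Defensive.

Import Order.TTheory GRing.Theory Num.Theory.
Import numFieldNormedType.Exports.

Local Open Scope classical_set_scope.
Local Open Scope ring_scope.

(* Paths on [0, oo[ are represented by functions on the whole of R that are
   constant on ]-oo, 0]; this normalization makes the representation unique. *)
Record cadlag_path (R : realType) (E : puniformType) := CadlagPath {
  cadlag_fun :> R -> E ;
  cadlag_right : forall t, 0 <= t -> cadlag_fun s @[s --> t^'+] --> cadlag_fun t ;
  cadlag_left : forall t, 0 < t -> cvg (cadlag_fun s @[s --> t^'-]) ;
  cadlag_neg : forall t, t < 0 -> cadlag_fun t = cadlag_fun 0 }.

Section skorokhod.
Variables (R : realType) (E : puniformType).
Local Notation D := (cadlag_path R E).

HB.instance Definition _ := gen_eqMixin D.
HB.instance Definition _ := gen_choiceMixin D.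

Lemma cst_cadlag_right (e : E) (t : R) :
  0 <= t -> (fun=> e) s @[s --> t^'+] --> (fun=> e) t.
Proof. by move=> _; exact: cvg_cst. Qed.

Lemma cst_cadlag_left (e : E) (t : R) :
  0 < t -> cvg ((fun=> e) s @[s --> t^'-]).
Proof. by move=> _; exact: is_cvg_cst. Qed.

Definition cst_cadlag (e : E) : D :=
  CadlagPath (@cst_cadlag_right e) (@cst_cadlag_left e) (fun _ _ => erefl).

HB.instance Definition _ := isPointed.Build D (cst_cadlag point).

(* The increasing bijections of [0, oo[ (automatically continuous). *)
Definition time_change : set (R -> R) :=
  [set l | set_bij `[0, +oo[ `[0, +oo[ l /\
           {in `[0, +oo[ &, {mono l : s t / s < t}}].

(* g_n --> f for the Skorokhod J1 topology iff, for all T, e and V, g_n is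
   eventually in skorokhod_ball f T e V (Ethier & Kurtz, Markov Processes,
   Proposition 3.5.3 (c)); as that topology is metrizable, these sets generate
   the filter of neighbourhoods of f. *)
Definition skorokhod_ball (f : D) (T e : R) (V : set (E * E)) : set D :=
  [set g | exists2 l : R -> R, time_change l &
     forall s, 0 <= s <= T -> `|l s - s| < e /\ V (f (l s), g s)].

Definition skorokhod_open (U : set D) : Prop :=
  forall f, U f -> exists T e V,
    [/\ 0 < T, 0 < e, entourage V & skorokhod_ball f T e V `<=` U].

Lemma sub_skorokhod_ball (f : D) (T T' e e' : R) (V V' : set (E * E)) :
  T <= T' -> e' <= e -> V' `<=` V ->
  skorokhod_ball f T' e' V' `<=` skorokhod_ball f T e V.
Proof.
move=> TT' ee' VV' g [l lt lP]; exists l => // s /andP[s0 sT].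
have [|h1 h2] := lP s; first by rewrite s0 (le_trans sT).
by split; [exact: lt_le_trans ee'|exact: VV'].
Qed.

Lemma skorokhod_openT : skorokhod_open setT.
Proof. by move=> f _; exists 1, 1, setT; split=> //; exact: filterT. Qed.

Lemma skorokhod_openI : setI_closed skorokhod_open.
Proof.
move=> A B oA oB f [/oA[T [e [V [T0 e0 eV sA]]]] /oB[T' [e' [V' [_ e0' eV' sB]]]]].
exists (Num.max T T'), (Num.min e e'), (V `&` V'); split.
- by rewrite lt_max T0.
- by rewrite lt_min e0 e0'.
- exact: filterI.
- move=> g gP; split; [apply: sA|apply: sB]; apply: sub_skorokhod_ball gP.
  + by rewrite le_max lexx.
  + by rewrite ge_min lexx.
  + exact: subIsetl.
  + by rewrite le_max lexx orbT.
  + by rewrite ge_min lexx orbT.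
  + exact: subIsetr.
Qed.

Lemma skorokhod_open_bigU (I : Type) (F : I -> set D) :
  (forall i, skorokhod_open (F i)) -> skorokhod_open (\bigcup_i F i).
Proof.
move=> oF f [i _ /oF[T [e [V [T0 e0 eV sF]]]]].
by exists T, e, V; split=> // g /sF Fg; exists i.
Qed.

HB.instance Definition _ := isOpenTopological.Build D
  skorokhod_openT skorokhod_openI skorokhod_open_bigU.

End skorokhod.

(* N_0^Z with the product of the discrete topologies. *)
Definition configuration : Type := prod_topology (fun _ : int => nat).

HB.instance Definition _ := Uniform.on configuration.
HB.instance Definition _ := isPointed.Build configuration (fun=> 0%N).

(* D(R_+; N_0^Z) with the Borel sigma-algebra of the Skorokhod topology. *)
Definition path_space (R : realType) :=
  g_sigma_algebraType (@open (cadlag_path R configuration)).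

Section kernel.
Variable R : realType.
Local Notation mu := (@lebesgue_measure R).

Definition sym_kernel (p : R -> R -> R) (u v : R) : R :=
  2^-1 * (p u v + p v u).

Local Open Scope ereal_scope.

Record kernel_assumptions (gamma : R) (p : R -> R -> R) : Prop := {
  kernel_ge0 : forall u v, u != v -> (0 <= p u v)%R ;
  kernel_diag : forall u, p u u = 0%R ;
  kernel_K1 : forall K : set (R * R), compact K ->
    K `<=` [set z | z.1 != z.2] ->
    [lipschitz (p z.1 z.2 : R^o) | z in K] ;
  kernel_gamma : (0 < gamma)%R ;
  kernel_K2 : forall u v lambda, u != v -> (0 < lambda)%R ->
    p (lambda * u)%R (lambda * v)%R = (lambda `^ (- (1 + gamma)) * p u v)%R ;
  kernel_K3 : forall K : set R, compact K ->
    \int[mu]_(u in K) \int[mu]_v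
      (sym_kernel p u v * Num.min `|u - v| 1)%:E < +oo ;
  kernel_K4 :
    ereal_sup [set \esum_(y in [set y : int | y != x])
                     (sym_kernel p x%:~R y%:~R)%:E | x in @setT int] < +oo ;
  kernel_K5 : forall r : R, (0 < r)%R ->
    limf_esup (fun e : R => limn_esup (fun N : nat =>
      (N%:R `^ gamma / N%:R ^+ 2)%:E *
      \esum_(x in [set x : int | (`|x%:~R| < r * N%:R)%R])
      \esum_(y in [set y : int | (`|(y - x)%:~R| <= e * N%:R)%R])
        (sym_kernel p x%:~R y%:~R * `|(x - y)%:~R|)%:E)) 0^'+ = 0%E ;
  kernel_K6 : forall r : R, (0 < r)%R ->
    limn_esup (fun m : nat => limn_esup (fun N : nat =>
      (N%:R `^ gamma / N%:R)%:E *
      \esum_(x in [set x : int | (`|x%:~R| < r * N%:R)%R])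
      \esum_(y in [set y : int | ((m%:R : R) * N%:R <= `|y%:~R|)%R])
        (sym_kernel p x%:~R y%:~R)%:E)) = 0%E }.

End kernel.

Section test_function.
Variable R : realType.

(* Only the values G t u with 0 <= t matter. *)
Definition supp (G : R -> R -> R) : set (R * R) :=
  closure [set z | 0 <= z.1 /\ G z.1 z.2 != 0].

(* The time derivative at 0 is one-sided. *)
Record test_function (G : R -> R -> R) : Prop := {
  test_continuous :
    {within [set z : R * R | 0 <= z.1], continuous (fun z => G z.1 z.2)} ;
  test_compact : compact (supp G) ;
  test_C1_time : forall u, exists2 dG : R -> R,
    {within `[0, +oo[, continuous dG} &
    forall t, 0 <= t ->
      (G s u - G t u) / (s - t) @[s --> within [set s | 0 <= s] t^']
        --> dG t ;
  test_smooth_space : forall t n u, 0 <= t ->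
    derivable (derive1n n (G t)) u 1 }.

End test_function.

Section averages.
Variable R : realType.

Definition A_ (r : R) : set (R * R) :=
  ~` [set z | r <= `|z.1| /\ r <= `|z.2|].

Definition A_eps (r e : R) : set (R * R) :=
  A_ r `&` [set z | e < `|z.1 - z.2| < e^-1].

Definition scaled (N : nat) (A : set (R * R)) : set (int * int) :=
  [set z | A (z.1%:~R / N%:R, z.2%:~R / N%:R)].

Definition block_avg (l : nat) (eta : configuration) (x : int) : R :=
  (2 * l + 1)%:R^-1 *
  \sum_(z \in [set z : int | `|z| <= l%:Z]) ((eta (x + z))%:R : R).

Definition H_ (p G : R -> R -> R) (t u v : R) : R := p u v * (G t v - G t u).

End averages.

(* Main.v *)
(** With [F] the function [H_t] restricted to [A_eps r eps'] and
    [phi (x, y) = eta x (kappa - eta y)], moving the two block averages from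
    [phi] onto [F] writes the sum as an average, over shifts [z] of size at most
    [eps N], of the sums of [(F w - F (w - z)) phi w].  These increments are
    uniformly small in time when [w] and [w - z] both lie in the set, because
    [H_t] is uniformly continuous there; otherwise they are bounded and [w] is
    confined to strips of width [O(eps N)] around finitely many lines.  As
    [|phi (x, y)| <= (kappa + 1) (eta x ^ 2 + eta y ^ 2)], the second moment
    bound yields an estimate [O(omega (eps) + eps)].

    Exchanging the expectation with finite sums requires the measurability of
    [eta |-> int_0^T (eta_t x)^2 dt]: "[eta x] takes the value [n] during the open
    time interval [I]" is a Skorokhod-open event, so that right-continuity makes
    evaluations, and then [(eta, t) |-> eta_t x], measurable. *)

Require Import Defs.
From HB Require Import structures.
From mathcomp Require Import all_boot all_order all_algebra.
From mathcomp Require Import all_classical all_reals all_analysis.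
From mathcomp Require Import measurable_realfun.
From mathcomp Require Import ring lra zify.

Set Implicit Arguments.
Unset Strict Implicit.
Unset Printing Implicit Defensive.

Import Order.TTheory GRing.Theory Num.Theory.
Import numFieldNormedType.Exports.

Local Open Scope classical_set_scope.
Local Open Scope ring_scope.

(** * Measurability of the occupation variables *)

Section evaluation.
Variable R : realType.
Local Notation D := (cadlag_path R configuration).

(** Serves as the set [V] of a Skorokhod ball: two paths close for it agree exactly at site [x].
    Since [nat] is discrete its diagonal is an entourage, and pulling it back along one projection
    gives a generator of the product uniformity. *)
Lemma entourage_coordinate (x : int) :
  entourage [set z : configuration * configuration | z.1 x = z.2 x].
Proof.
pose T := fun _ : int => nat.
pose V := [set z : nat * nat | z.1 = z.2].
have eV : entourage V by rewrite uniform_discrete /discrete_ent => _ [n _ <-].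
have eW : @entourage (initial_topology (@proj int T x))
    [set z : configuration * configuration | z.1 x = z.2 x].
  by exists V.
exists [set z : configuration * configuration | z.1 x = z.2 x] => //.
pose W := [set z : (forall i, T i) * (forall i, T i) | z.1 x = z.2 x].
pose ent_of (q : {classic int} * set ((forall i, T i) * (forall i, T i))) :=
  `[< @entourage (initial_topology (@proj int T q.1)) q.2 >].
have eW' : ent_of (x : {classic int}, W) by exact/asboolP.
exact: (@finI_from1 {q | ent_of q} _ setT (fun q => (projT1 q).2)
  (exist _ (x : {classic int}, W) eW')).
Qed.

(** A right-continuous map into a discrete space is locally constant to the right; at negative times
    the path is constant by normalization. *)
Lemma cadlag_coordinate (f : D) (x : int) (t : R) :
  \forall s \near t^'+, f s x = f t x.
Proof.
have [t0|t0] := leP 0 t; last first.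
  apply: filterS (nbhs_right_lt t0) => s s0.
  by rewrite (cadlag_neg f t0) (cadlag_neg f s0).
have := cvg_comp _ _ (@cadlag_right _ _ f t t0)
  (@proj_continuous int (fun=> nat) x (f t)).
by move/(_ [set f t x]); apply; exact: discrete_set1.
Qed.

Lemma cadlag_coordinateP (f : D) (x : int) (t : R) : exists2 d : R, 0 < d &
  forall s, t <= s < t + d -> f s x = f t x.
Proof.
have [d /= d0 H] := cadlag_coordinate f x t; exists d => // s /andP[].
rewrite le_eqVlt => /predU1P[<-//|ts std]; apply: H => //=.
by rewrite ltr_distlC; lra.
Qed.

(* A time change moves times by less than any prescribed amount, so a value
   taken strictly inside a time window is still taken there nearby. *)
Lemma open_hits (x : int) (n : nat) (a b : R) : 0 <= a ->
  open [set f : D | exists2 s, a < s < b & f s x = n].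
Proof.
move=> a0.
change (skorokhod_open [set f : D | exists2 s, a < s < b & f s x = n]).
move=> f [s /andP[as_ sb] fs].
pose e := Num.min (s - a) (b - s).
have e0 : 0 < e by rewrite /e lt_min; apply/andP; split; lra.
have [ea eb] : e <= s - a /\ e <= b - s.
  by rewrite /e !ge_min !lexx orbT.
exists (s + e + 1), e, [set z : configuration * configuration | z.1 x = z.2 x].
split=> //; [by lra|exact: entourage_coordinate|].
move=> g [l [lb lm] lP].
have [s' s'0 ls'] : exists2 s', 0 <= s' & l s' = s.
  case: lb => _ _ /(_ s) [|s' /= + ls']; rewrite /= in_itv/= andbT.
    by lra.
  by exists s'.
have s'T : s' <= s + e + 1.
  (* If [s'] lay beyond the horizon, monotonicity would give [l (s + e + 1) < s], whereas [l] moves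
     the horizon by less than [e], to a time above [s + 1]. *)
  rewrite leNgt; apply/negP => Ts'.
  have T0 : 0 <= s + e + 1 by lra.
  have := lm (s + e + 1) s'; rewrite !in_itv/= !andbT => /(_ T0 s'0).
  rewrite Ts' ls'.
  have [|+ _] := lP (s + e + 1); first by rewrite T0 lexx.
  by rewrite ltr_distl => /andP[? ?] ?; lra.
have [|+ fg] := lP s'; first by rewrite s'0.
rewrite ls' ltr_distl => /andP[? ?].
exists s'; first by apply/andP; split; lra.
by move: fg; rewrite /= ls' => <-.
Qed.

(** Because the coordinate is constant just after [t], its value at [t] is [n] exactly when [n] is
    taken in every window []t, t + 1/(k+1)[]. This is a countable intersection of open events. *)
Lemma measurable_coordinate (x : int) (t : R) (n : nat) :
  measurable [set f : path_space R | f t x = n].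
Proof.
wlog t0 : t / 0 <= t.
  move=> H; have [|t0] := leP 0 t; first exact: H.
  rewrite [X in measurable X](_ : _ = [set f : path_space R | f 0 x = n]).
    exact: H.
  by apply/seteqP; split=> f /=; rewrite (cadlag_neg f t0).
have -> : [set f : path_space R | f t x = n] =
    \bigcap_k [set f : path_space R |
      exists2 s, t < s < t + k.+1%:R^-1 & f s x = n].
  apply/seteqP; split=> [f /= ftx k _ /=|f fH].
    have [d d0 dP] := cadlag_coordinateP f x t.
    have : 0 < k.+1%:R^-1 :> R by rewrite invr_gt0 ltr0Sn.
    move: (k.+1%:R^-1) => q q0.
    pose e := Num.min d q.
    have e0 : 0 < e by rewrite /e lt_min d0.
    have [ed eq] : e <= d /\ e <= q by rewrite /e !ge_min !lexx orbT.
    exists (t + e / 2); first by apply/andP; split; lra.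
    by rewrite -ftx; apply: dP; apply/andP; split; lra.
  have [d d0 dP] := cadlag_coordinateP f x t.
  have [k kd] : exists k, k.+1%:R^-1 < d.
    by have /cvgrPdist_lt /(_ _ d0)[k _ /(_ k (leqnn k))] := @cvg_harmonic R;
      rewrite /= sub0r normrN ger0_norm ?invr_ge0//; exists k.
  have [s /andP[ts st] <-] := fH k I.
  by rewrite /= -(dP s)// ltW//= (lt_trans st)// ltrD2l.
apply: bigcapT_measurable => k; apply: sub_sigma_algebra.
exact: open_hits.
Qed.

Lemma measurable_joint_coordinate (x : int) :
  measurable_fun setT (fun z : path_space R * R => (z.1 z.2 x)%:R : R).
Proof.
(* The first point of the grid of mesh [1/(k+1)] strictly after [t]: approaching from the right, the
   sampled value is eventually equal to the value at [t]. *)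
pose tk (k : nat) (t : R) := (Num.floor (k.+1%:R * t) + 1)%:~R / k.+1%:R : R.
apply: (@measurable_fun_cvg _ _ _ _
    (fun k (z : path_space R * R) => (z.1 (tk k z.2) x)%:R : R)); last first.
  move=> [f t] _ /=.
  have [d d0 dP] := cadlag_coordinateP f x t.
  apply: cvg_near_cst.
  have /cvgrPdist_lt /(_ _ d0)[k _ kP] := @cvg_harmonic R.
  exists k => // m /kP; rewrite /= sub0r normrN ger0_norm ?invr_ge0// => md.
  rewrite (dP (tk m t))// /tk.
  have m0 : (0 : R) < m.+1%:R by [].
  have /andP[h1 h2] := floor_itv (m.+1%:R * t).
  rewrite ler_pdivlMr// ltr_pdivrMr// mulrC ltW//=.
  rewrite mulrDl (@le_lt_trans _ _ (m.+1%:R * t + 1))//.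
    by rewrite intrD1 lerD2r.
  by rewrite [t * _]mulrC ltrD2l -ltr_pdivrMr// mul1r.
move=> k _ B mB; rewrite setTI.
(* The sampling time is constant on each grid cell, so the preimage is a countable union of
   measurable rectangles. *)
have -> : (fun z : path_space R * R => (z.1 (tk k z.2) x)%:R : R) @^-1` B =
  \bigcup_(n in [set n : nat | B n%:R]) \bigcup_(j : int)
    ([set f : path_space R | f (((j + 1)%:~R : R) / k.+1%:R) x = n] `*`
     [set t : R | Num.floor (k.+1%:R * t) = j]).
  apply/seteqP; split=> [[f t] /= Bf|[f t]/= [n Bn [j _ [/= fn fl]]]].
    by exists (f (tk k t) x) => //; exists (Num.floor (k.+1%:R * t)).
  by rewrite /tk fl fn.
apply: bigcup_measurable => n _.
apply: countable_bigcupT_measurable => // j; apply: measurableX.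
  exact: measurable_coordinate.
have -> : [set t : R | Num.floor (k.+1%:R * t) = j] =
    `[j%:~R / k.+1%:R, (j + 1)%:~R / k.+1%:R[%classic.
  apply/seteqP; split=> t /=; rewrite in_itv/= ler_pdivrMr// ltr_pdivlMr//.
    by move=> <-; rewrite ![t * _]mulrC floor_itv.
  by rewrite ![t * _]mulrC -floor_eq => /eqP.
exact: measurable_itv.
Qed.

Lemma measurable_sqr_coordinate_time (x : int) (f : D) :
  measurable_fun setT (fun t : R => (((f t x)%:R : R) ^+ 2)%:E).
Proof.
apply/measurable_EFinP; apply: measurable_funX.
exact: (measurableT_comp (measurable_joint_coordinate x)
  (@pair1_measurable _ _ (path_space R) R f)).
Qed.

Lemma measurable_sqr_coordinate_integral (x : int) (T : R) :
  measurable_fun setT (fun f : path_space R =>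
    \int[lebesgue_measure]_(t in `[0%R, T]) (((f t x)%:R : R) ^+ 2)%:E)%E.
Proof.
(* The time window becomes an indicator factor, so that Tonelli applies to a jointly measurable
   function on the whole product. *)
pose g (z : path_space R * R) : \bar R :=
  ((((z.1 z.2 x)%:R : R) ^+ 2) * \1_`[0%R, T] z.2)%:E.
have mg : measurable_fun setT g.
  apply/measurable_EFinP; apply: measurable_funM.
    by apply: measurable_funX; exact: measurable_joint_coordinate.
  have mI : measurable_fun setT (\1_`[0%R, T] : R -> R).
    by apply: measurable_indic; exact: measurable_itv.
  exact: (measurableT_comp mI measurable_snd).
have g0 z : (0 <= g z)%E by rewrite lee_fin mulr_ge0// sqr_ge0.
rewrite [X in measurable_fun _ X](_ : _ =
    fubini_F (@lebesgue_measure R) g).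
  exact: measurable_fun_fubini_tonelli_F.
apply/funext => f; rewrite /fubini_F [LHS]integral_mkcond.
apply: eq_integral => t _ /=; rewrite /g patchE /= indicE.
by case: ifPn => _; rewrite ?mulr1 ?mulr0.
Qed.

End evaluation.

(** * Monotone integrals, limits superior, uniform continuity *)

Section analysis.
Variable R : realType.

Section ge0_le.
Context d (T : measurableType d) (mu : {measure set T -> \bar R}).
Local Open Scope ereal_scope.

(* The integral of a nonnegative function is a supremum over the simple
   functions below it, hence monotone without any measurability. *)
Lemma ge0_le_integral_nomeas (D : set T) (f g : T -> \bar R) :
  (forall x, D x -> 0 <= f x) -> (forall x, D x -> f x <= g x) ->
  \int[mu]_(x in D) f x <= \int[mu]_(x in D) g x.
Proof.
move=> f0 fg; rewrite !ge0_integralE//; last first.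
  by move=> x Dx; rewrite (le_trans (f0 x Dx))// fg.
apply: ge_ereal_sup => _ [h hf <-]; apply: ereal_sup_ubound; exists h => // x.
apply: (le_trans (hf x)); rewrite !patchE; case: ifPn => // /set_mem Dx.
exact: fg.
Qed.
End ge0_le.

Lemma limf_esup_le_near (T : choiceType) (X : filteredType T) (u : X -> \bar R)
    (F : set_system X) (c : \bar R) :
  (\forall x \near F, u x <= c)%E -> (limf_esup u F <= c)%E.
Proof.
move=> H; apply: (@le_trans _ _ (ereal_sup (u @` [set x | (u x <= c)%E]))).
  by apply: ereal_inf_lbound; exists [set x | (u x <= c)%E].
by apply: ge_ereal_sup => _ [x /= + <-].
Qed.

Lemma limn_esup_fin_bound (u : nat -> \bar R) : (limn_esup u < +oo)%E ->
  exists2 C : R, 0 <= C & \forall n \near \oo, (u n <= C%:E)%E.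
Proof.
move=> /ereal_inf_lt[_ [V VF <-]] supV.
have [C C0 HC] : exists2 C : R, 0 <= C & (ereal_sup (u @` V) <= C%:E)%E.
  case: (ereal_sup (u @` V)) supV => [r _|//|_].
    by exists `|r| => //; rewrite lee_fin ler_norm.
  by exists 0 => //; rewrite leNye.
exists C => //; apply: filterS VF => n Vn.
by apply: le_trans HC; apply: ereal_sup_ubound; exists n.
Qed.

(** Compactness is used in its near-covering form: it suffices to find, around each point of [K], a
    range of [d] valid for all nearby points at once. *)
Lemma heine_cantor (K : set (R * R)) (f : R * R -> R) (e : R) :
  compact K -> {within K, continuous f} -> 0 < e ->
  exists2 d : R, 0 < d & forall z w, K z -> K w ->
    `|z.1 - w.1| < d -> `|z.2 - w.2| < d -> `|f z - f w| < e.
Proof.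
move=> cK cf e0.
have /near_covering_withinP : near_covering K by exact/compact_near_coveringP.
move=> /(_ R 0^'+ (fun d z => forall w, K w ->
    `|z.1 - w.1| < d -> `|z.2 - w.2| < d -> `|f z - f w| < e)) H.
have {H} [|d /= d0 dP] := H _; last first.
  have d20 : 0 < d / 2 by rewrite divr_gt0.
  exists (d / 2) => // z w Kz Kw.
  by apply: dP => //=; rewrite distrC subr0 gtr0_norm// ltr_pdivrMr//; lra.
move=> z0 Kz0.
have e20 : 0 < e / 2 by rewrite divr_gt0.
have /(_ _ Kz0)/cvgrPdist_lt/(_ _ e20) := (subspace_continuousP K f).1 cf.
rewrite near_withinE => -[[A B]/=].
move=> [/nbhs_ballP[a /= a0 aA] /nbhs_ballP[b /= b0 bB]] AB.
(* Half the radius, so that [z] within [c] of [z0] and [w] within [c] of [z] are both in the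
   neighbourhood where [f] is [e / 2]-close to [f z0]. *)
pose c := Num.min a b / 2.
have c0 : 0 < c by rewrite /c divr_gt0// lt_min a0.
have [ca cb] : c + c <= a /\ c + c <= b.
  by rewrite /c -splitr !ge_min !lexx orbT.
have near0 w : `|z0.1 - w.1| < c + c -> `|z0.2 - w.2| < c + c -> K w ->
    `|f z0 - f w| < e / 2.
  move=> h1 h2; apply: (AB w); split; [apply: aA|apply: bB] => /=.
    exact: lt_le_trans ca.
  exact: lt_le_trans cb.
exists (ball z0 c, ball (0 : R) c `&` [set d : R | 0 < d]) => /=.
  split; first exact: nbhsx_ballx.
  exists c => //= d; rewrite /ball/= => dc d0; split => //.
move=> [z d] /= [[z1 z2] [dc d0]] Kz w Kw w1 w2.
have dc' : d < c by move: dc; rewrite /ball/= sub0r normrN gtr0_norm.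
rewrite -(subrK (f z0) (f z)) -addrA (splitr e) (le_lt_trans (ler_normD _ _))//.
rewrite ltrD//.
  rewrite distrC; apply: near0 => //; [move: z1|move: z2]; rewrite /ball/=; lra.
apply: near0 => //.
  rewrite -(subrK z.1 z0.1) -addrA (le_lt_trans (ler_normD _ _))//.
  by rewrite ltrD// (lt_trans w1).
rewrite -(subrK z.2 z0.2) -addrA (le_lt_trans (ler_normD _ _))//.
by rewrite ltrD// (lt_trans w2).
Qed.

Lemma compact_continuous_bounded (K : set (R * R)) (f : R * R -> R) :
  compact K -> {within K, continuous f} ->
  exists2 M : R, 0 <= M & forall z, K z -> `|f z| <= M.
Proof.
move=> cK cf.
have /compact_bounded[M [_ MP]] := continuous_compact cf cK.
exists (`|M| + 1); first by rewrite addr_ge0.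
move=> z Kz; apply: (MP (`|M| + 1)); last by exists z.
by rewrite (le_lt_trans (ler_norm M))// ltrDl.
Qed.
End analysis.

(** * Kernel and test function *)

Section kernel_estimates.
Variable R : realType.

(** For [e > 0] these compacts avoid the diagonal, so [kernel_K1] applies to them; with
    [b = r + e^-1] they contain [A_eps r e]. *)
Lemma compact_off_diagonal (b e : R) :
  compact [set z : R * R | [/\ `|z.1| <= b, `|z.2| <= b & e <= `|z.1 - z.2|]].
Proof.
have cB : compact (`[- b, b] `*` `[- b, b] : set (R * R)).
  by apply: compact_setX; exact: segment_compact.
apply: (subclosed_compact _ cB); last first.
  by move=> z [z1 z2 _]; split; rewrite /= in_itv/= -ler_norml.
have -> : [set z : R * R | [/\ `|z.1| <= b, `|z.2| <= b & e <= `|z.1 - z.2|]] =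
   ((fun z : R * R => `|z.1|) @^-1` [set x | x <= b]) `&`
   (((fun z : R * R => `|z.2|) @^-1` [set x | x <= b]) `&`
    ((fun z : R * R => `|z.1 - z.2|) @^-1` [set x | e <= x])).
  by apply/seteqP; split=> z /=; [case|case=> ? []].
have c1 : continuous (fun z : R * R => `|z.1|).
  by move=> z; apply: cvg_norm; exact: cvg_fst.
have c2 : continuous (fun z : R * R => `|z.2|).
  by move=> z; apply: cvg_norm; exact: cvg_snd.
have c3 : continuous (fun z : R * R => `|z.1 - z.2|).
  by move=> z; apply: cvg_norm; apply: cvgB; [exact: cvg_fst|exact: cvg_snd].
apply: closedI; [|apply: closedI].
- by apply: closed_comp; [move=> z _; exact: c1|exact: closed_le].
- by apply: closed_comp; [move=> z _; exact: c2|exact: closed_le].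
- by apply: closed_comp; [move=> z _; exact: c3|exact: closed_ge].
Qed.

Lemma A_epsP (r e : R) (z : R * R) : A_eps r e z <->
  [/\ `|z.1| < r \/ `|z.2| < r, e < `|z.1 - z.2| & `|z.1 - z.2| < e^-1].
Proof.
rewrite /A_eps /A_; split=> [[/= /not_andP h /andP[? ?]]|[h h1 h2]].
  by split=> //; case: h => /negP; rewrite -ltNge; [left|right].
split; last by apply/andP.
by move=> /= [h3 h4]; case: h; rewrite ltNge ?h3 ?h4.
Qed.

Lemma A_eps_bounded (r e : R) (z : R * R) : A_eps r e z ->
  `|z.1| <= r + e^-1 /\ `|z.2| <= r + e^-1.
Proof.
move=> /A_epsP[h h1 h2].
have d12 : `|z.1| <= `|z.2| + `|z.1 - z.2|.
  by rewrite -{1}(subrK z.2 z.1) addrC (le_trans (ler_normD _ _)).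
have d21 : `|z.2| <= `|z.1| + `|z.1 - z.2|.
  by rewrite -{1}(subrK z.1 z.2) addrC (le_trans (ler_normD _ _))// (distrC z.1).
have := normr_ge0 (z.1 - z.2).
by split; case: h => h; lra.
Qed.

Lemma kernel_lipschitz_bounded (gamma : R) (p : R -> R -> R) (b e : R) :
  kernel_assumptions gamma p -> 0 < e ->
  let K := [set z : R * R | [/\ `|z.1| <= b, `|z.2| <= b & e <= `|z.1 - z.2|]] in
  exists2 L, 0 <= L &
  [/\ forall z, K z -> `|p z.1 z.2| <= L & forall z w, K z -> K w ->
    `|p z.1 z.2 - p w.1 w.2| <= L * Num.max `|z.1 - w.1| `|z.2 - w.2|].
Proof.
move=> hp e0 K.
have cK : compact K by exact: compact_off_diagonal.
have [|L [_ LP]] := kernel_K1 hp cK.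
  move=> z [_ _ ez] /=; apply/eqP => zz; move: ez.
  by rewrite zz subrr normr0 leNgt e0.
(* The Lipschitz property holds for every constant above the threshold [L]; [|L| + 1] is such a
   constant and is positive. *)
have {LP} LP z w : K z -> K w -> `|p z.1 z.2 - p w.1 w.2| <=
    (`|L| + 1) * Num.max `|z.1 - w.1| `|z.2 - w.2|.
  move=> Kz Kw; apply: (LP (`|L| + 1) _ (z, w)) => //.
  by rewrite (le_lt_trans (ler_norm L))// ltrDl.
have [->|/set0P[z0 Kz0]] := eqVneq K set0.
  by exists 0.
(* One constant for both claims: the Lipschitz constant, plus the value at a base point and the
   largest variation over [K], whose diameter is at most [2|b|]. *)
exists (`|L| + 1 + (`|p z0.1 z0.2| + (`|L| + 1) * (`|b| + `|b|))).
  by rewrite !addr_ge0// mulr_ge0// addr_ge0.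
split=> [z Kz|z w Kz Kw].
  rewrite -(subrK (p z0.1 z0.2) (p z.1 z.2)) addrC.
  rewrite (le_trans (ler_normD _ _))// ler_wpDl ?addr_ge0//.
  rewrite lerD// (le_trans (LP _ _ Kz Kz0))// ler_wpM2l ?addr_ge0//.
  case: Kz => ? ? _; case: Kz0 => ? ? _; have := ler_norm b.
  by rewrite ge_max => ?; apply/andP; split; rewrite (le_trans (ler_normB _ _))//; lra.
apply: (le_trans (LP _ _ Kz Kw)); rewrite ler_wpM2r ?le_max ?normr_ge0//.
by rewrite lerDl addr_ge0// mulr_ge0// addr_ge0.
Qed.

Lemma H_bounded_unif_continuous (gamma : R) (p G : R -> R -> R) (T r e : R) :
  kernel_assumptions gamma p -> test_function G -> 0 < e ->
  (exists2 M, 0 <= M & forall t z, 0 <= t <= T -> A_eps r e z ->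
    `|H_ p G t z.1 z.2| <= M) /\
  (forall om, 0 < om -> exists2 d, 0 < d & forall t z w, 0 <= t <= T ->
    A_eps r e z -> A_eps r e w -> `|z.1 - w.1| < d -> `|z.2 - w.2| < d ->
    `|H_ p G t z.1 z.2 - H_ p G t w.1 w.2| <= om).
Proof.
move=> hp hG e0; pose b := r + e^-1.
have [L L0 [pL pLip]] := kernel_lipschitz_bounded b hp e0.
pose K := `[0, T]%classic `*` `[- b, b]%classic : set (R * R).
have cK : compact K by apply: compact_setX; exact: segment_compact.
have cG : {within K, continuous (fun z : R * R => G z.1 z.2)}.
  apply: (continuous_subspaceW _ (test_continuous hG)) => z [] /=.
  by rewrite in_itv/= => /andP[].
have [B B0 GB] := compact_continuous_bounded cK cG.
have inK t u : 0 <= t <= T -> `|u| <= b -> K (t, u).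
  by move=> tT ub; split; rewrite /= in_itv/= -?ler_norml.
have inA z : A_eps r e z -> [/\ `|z.1| <= b, `|z.2| <= b & e <= `|z.1 - z.2|].
  by move=> Az; have [? ?] := A_eps_bounded Az; case/A_epsP: Az => _ /ltW.
have dG t z : 0 <= t <= T -> A_eps r e z -> `|G t z.2 - G t z.1| <= B + B.
  move=> tT /inA[z1 z2 _]; rewrite (le_trans (ler_normB _ _))//.
  by rewrite lerD//; [apply: (GB (t, z.2))|apply: (GB (t, z.1))]; exact: inK.
split.
  exists (L * (B + B)); first by rewrite mulr_ge0// addr_ge0.
  move=> t z tT Az; rewrite /H_ normrM ler_pM//; last exact: dG.
  exact/pL/inA.
move=> om om0.
(* The two terms of the product rule below get [om / 2] each: [L] times two increments of [G], and
   the increment of [p] times at most [2B]. Adding 1 to [L] and [B] keeps the denominators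
   positive. *)
have e1 : 0 < om / (4 * (L + 1)) by rewrite divr_gt0// mulr_gt0//; lra.
have [d1 d10 d1P] := heine_cantor cK cG e1.
have e2 : 0 < om / (4 * (L + 1) * (B + 1)).
  by rewrite divr_gt0// mulr_gt0//; nra.
exists (Num.min d1 (om / (4 * (L + 1) * (B + 1)))).
  by rewrite lt_min d10.
move=> t z w tT Az Aw; rewrite !lt_min => /andP[z1 z1'] /andP[z2 z2'].
have [zb1 zb2 _] := inA _ Az; have [wb1 wb2 _] := inA _ Aw.
rewrite /H_ (_ : _ - _ = p z.1 z.2 * ((G t z.2 - G t w.2) - (G t z.1 - G t w.1)) +
  (p z.1 z.2 - p w.1 w.2) * (G t w.2 - G t w.1)); last by ring.
have tt : `|t - t| < d1 by rewrite subrr normr0.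
have g2 := d1P (t, z.2) (t, w.2) (inK _ _ tT zb2) (inK _ _ tT wb2) tt z2.
have g1 := d1P (t, z.1) (t, w.1) (inK _ _ tT zb1) (inK _ _ tT wb1) tt z1.
rewrite (le_trans (ler_normD _ _))// !normrM (splitr om) lerD//.
  apply: (@le_trans _ _ (L * (om / (4 * (L + 1)) + om / (4 * (L + 1))))).
    rewrite ler_pM//; first exact/pL/inA.
    by rewrite (le_trans (ler_normB _ _))// lerD// ltW.
  have : om / (4 * (L + 1)) * (4 * (L + 1)) = om.
    by rewrite divfK// gt_eqF// mulr_gt0//; lra.
  move: (om / (4 * (L + 1))) e1 => q q0 <-; nra.
apply: (@le_trans _ _ (L * (om / (4 * (L + 1) * (B + 1))) * (B + B))).
  rewrite ler_pM//; last exact: dG.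
  rewrite (le_trans (pLip _ _ (inA _ Az) (inA _ Aw)))// ler_wpM2l// ge_max.
  by rewrite !ltW.
have : om / (4 * (L + 1) * (B + 1)) * (4 * (L + 1) * (B + 1)) = om.
  by rewrite divfK// gt_eqF//; nra.
move: (om / (4 * (L + 1) * (B + 1))) e2 => q q0 <-.
have := mulr_ge0 (ltW q0) L0; have := mulr_ge0 (ltW q0) B0; nra.
Qed.

End kernel_estimates.

(** * Sums over the lattice *)

Section lattice_sums.
Variable R : realType.

Definition ibox (m : nat) : seq int :=
  [seq (i%:Z - m%:Z)%R | i <- iota 0 (2 * m + 1)].

Lemma ibox_uniq (m : nat) : uniq (ibox m).
Proof. by rewrite map_inj_uniq ?iota_uniq// => i j; lia. Qed.

Lemma size_ibox (m : nat) : size (ibox m) = (2 * m + 1)%N.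
Proof. by rewrite size_map size_iota. Qed.

Lemma mem_ibox (m : nat) (x : int) : (x \in ibox m) = (`|x| <= m)%N.
Proof.
apply/mapP/idP => [[i]|xm]; first by rewrite mem_iota => ? ->; lia.
by exists (absz (x + m%:Z)); rewrite ?mem_iota; lia.
Qed.

(** The integers counted lie in the list [t], which starts at the ceiling of [a - h] and has
    [floor (2h) + 1] entries. *)
Lemma count_close_integers (s : seq int) (a h : R) : uniq s -> 0 <= h ->
  \sum_(x <- s) (`|(x%:~R : R) - a| <= h)%R%:R <= 2 * h + 1 :> R.
Proof.
move=> us h0; pose lo := Num.ceil (a - h).
pose t := [seq (lo + i%:Z)%R | i <- iota 0 (Num.truncn (2 * h)).+1].
have -> : \sum_(x <- s) (`|(x%:~R : R) - a| <= h)%R%:R =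
    (size [seq x <- s | `|(x%:~R : R) - a| <= h])%:R :> R.
  by rewrite size_filter -sum1_count natr_sum [RHS]big_mkcond/=;
     apply: eq_bigr => x _; case: ifP.
apply: (@le_trans _ _ (size t)%:R).
  rewrite ler_nat; apply: uniq_leq_size; first by rewrite filter_uniq.
  move=> x; rewrite mem_filter ler_distl => /andP[/andP[ax xa] _].
  have lox : lo <= x by rewrite /lo ceil_le_int.
  apply/mapP; exists (absz (x - lo)); last by lia.
  rewrite mem_iota /= add0n ltnS truncn_ge_nat; last by lra.
  rewrite natr_absz ger0_norm; last by lia.
  rewrite intrD intrN; have := ceil_ge (a - h); rewrite -/lo; lra.
rewrite size_map size_iota -natr1 lerD2r truncn_le; lra.
Qed.

Lemma fsum_ibox (m : nat) (g : int * int -> R) :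
  (forall w, g w != 0 -> w.1 \in ibox m /\ w.2 \in ibox m) ->
  \sum_(w \in [set: int * int]) g w =
  \sum_(x <- ibox m) \sum_(y <- ibox m) g (x, y).
Proof.
move=> gm; rewrite -big_allpairs.
rewrite (fsbigE (allpairs pair (ibox m) (ibox m)))//=.
- by apply: eq_bigl => w; rewrite in_setT.
- by apply: allpairs_uniq => //; [exact: ibox_uniq|exact: ibox_uniq|move=> [? ?] [? ?]].
- move=> [x y] _; apply: contraNeq => /gm[? ?].
  by apply/allpairsP; exists (x, y).
Qed.

Lemma block_avgE (l : nat) (eta : configuration) (x : int) :
  block_avg R l eta x =
  (2 * l + 1)%:R^-1 * \sum_(z <- ibox l) ((eta (x + z))%:R : R).
Proof.
rewrite /block_avg (_ : [set z : int | `|z| <= l%:Z] = [set` ibox l]).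
  by rewrite -fsbig_seq// ibox_uniq.
by apply/seteqP; split=> z /=; rewrite mem_ibox; lia.
Qed.

(** For natural [a] one has [a <= a ^ 2], which absorbs the linear term [kappa a]; the product [a b]
    is at most half of [a ^ 2 + b ^ 2]. *)
Lemma occupation_product_bound (kappa : nat) (a b : nat) :
  `|(a%:R * (kappa%:R - b%:R) : R)| <= (kappa%:R + 1) * (a%:R ^+ 2 + b%:R ^+ 2).
Proof.
have aa : (a%:R : R) <= a%:R ^+ 2 by rewrite -natrX ler_nat; nia.
have a0 : 0 <= a%:R :> R by [].
have b0 : 0 <= b%:R :> R by [].
have k0 : 0 <= kappa%:R :> R by [].
move: (a%:R : R) (b%:R : R) (kappa%:R : R) aa a0 b0 k0 => {}a {}b k aa a0 b0 k0.
rewrite normrM ger0_norm//.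
apply: (@le_trans _ _ (a * (k + b))).
  rewrite ler_wpM2l// (le_trans (ler_normB _ _))// !ger0_norm//.
rewrite mulrDr.
have : 0 <= k * (a ^+ 2 - a) by rewrite mulr_ge0// subr_ge0.
have : 0 <= k * b ^+ 2 by rewrite mulr_ge0// sqr_ge0.
have : 0 <= (a - b) ^+ 2 by rewrite sqr_ge0.
have : 0 <= a ^+ 2 by rewrite sqr_ge0.
have : 0 <= b ^+ 2 by rewrite sqr_ge0.
nra.
Qed.

End lattice_sums.

(** * Transfer of the block averages to the coefficients *)

Section shift.
Variable R : realType.

Lemma fsum_restrict_ibox (m : nat) (A : set (int * int)) (F g : int * int -> R) :
  (forall w, A w -> w.1 \in ibox m /\ w.2 \in ibox m) ->
  \sum_(w \in A) F w * g w =
  \sum_(x <- ibox m) \sum_(y <- ibox m) (F \_ A) (x, y) * g (x, y).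
Proof.
move=> Am; rewrite fsbig_mkcond -(fsum_ibox (g := fun w => (F \_ A) w * g w)).
  by apply: eq_fsbigr => w _; rewrite !patchE; case: ifP; rewrite ?mul0r.
by move=> w; rewrite patchE; case: ifPn => [/set_mem/Am//|]; rewrite mul0r eqxx.
Qed.

(** The margin [l] between [A] and the box keeps the translated support inside the box, so both
    sides are sums over the whole lattice, on which translation is a bijection. *)
Lemma shift_ibox (l m : nat) (A : set (int * int)) (F g : int * int -> R)
    (z : int * int) :
  (forall w, A w -> (`|w.1| + l <= m)%N /\ (`|w.2| + l <= m)%N) ->
  (`|z.1| <= l)%N -> (`|z.2| <= l)%N ->
  \sum_(x <- ibox m) \sum_(y <- ibox m) (F \_ A) (x, y) * g (x + z.1, y + z.2) =
  \sum_(x <- ibox m) \sum_(y <- ibox m) (F \_ A) (x - z.1, y - z.2) * g (x, y).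
Proof.
move=> Am z1 z2.
have Fm w : (F \_ A) w != 0 -> (`|w.1| + l <= m)%N /\ (`|w.2| + l <= m)%N.
  by rewrite patchE; case: ifPn => [/set_mem/Am//|]; rewrite eqxx.
rewrite -(fsum_ibox (g := fun w => (F \_ A) w * g (w.1 + z.1, w.2 + z.2))); last first.
  move=> w; rewrite mulf_eq0 negb_or => /andP[/Fm[] + +] _.
  by rewrite !mem_ibox; lia.
rewrite -(fsum_ibox (g := fun w => (F \_ A) (w.1 - z.1, w.2 - z.2) * g w)); last first.
  move=> w; rewrite mulf_eq0 negb_or => /andP[/Fm[/=] + +] _.
  by rewrite !mem_ibox; lia.
rewrite [RHS](reindex_fsbigT (fun w : int * int => (w.1 + z.1, w.2 + z.2))).
  by apply: eq_fsbigr => -[x y] _ /=; rewrite !addrK.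
by exists (fun w : int * int => (w.1 - z.1, w.2 - z.2)) => -[x y] /=;
  rewrite ?addrK ?subrK.
Qed.

(* Moving the block average from the occupation variables onto the coefficients
   turns the error into an average of increments of the coefficients. *)
Lemma block_replacement_bound (kappa l m : nat) (A : set (int * int))
    (F : int * int -> R) (eta : configuration) (c : int -> int -> R) :
  (forall w, A w -> (`|w.1| + l <= m)%N /\ (`|w.2| + l <= m)%N) ->
  (forall x y z z', (`|z| <= l)%N -> (`|z'| <= l)%N ->
    `|(F \_ A) (x, y) - (F \_ A) (x - z, y - z')| <= c x y) ->
  `|\sum_(w \in A) F w *
      ((eta w.1)%:R * (kappa%:R - (eta w.2)%:R)
       - block_avg R l eta w.1 * (kappa%:R - block_avg R l eta w.2))| <=
  \sum_(x <- ibox m) ((kappa%:R + 1) * \sum_(y <- ibox m) (c x y + c y x)) *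
    (eta x)%:R ^+ 2.
Proof.
move=> Am Fc.
have Am' w : A w -> w.1 \in ibox m /\ w.2 \in ibox m.
  by move=> /Am; rewrite !mem_ibox; lia.
pose phi (w : int * int) : R := (eta w.1)%:R * (kappa%:R - (eta w.2)%:R).
pose n : R := (2 * l + 1)%:R.
have n0 : 0 < n by rewrite ltr0n addn1.
have sum_n (a : R) : \sum_(z <- ibox l) a = n * a.
  by rewrite big_const_seq count_predT size_ibox iter_addr_0 -mulr_natl.
have nK (a : R) : n^-1 ^+ 2 * (n * (n * a)) = a by field; rewrite gt_eqF.
have avgE w : block_avg R l eta w.1 * (kappa%:R - block_avg R l eta w.2) =
    n^-1 ^+ 2 * \sum_(z <- ibox l) \sum_(z' <- ibox l) phi (w.1 + z, w.2 + z').
  rewrite !block_avgE -/n.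
  (* Writing [kappa] as its own average turns the product of averages into a double average of
     shifted values of [phi]. *)
  rewrite (_ : kappa%:R = n^-1 * \sum_(z <- ibox l) kappa%:R :> R); last first.
    by rewrite sum_n mulKf// gt_eqF.
  rewrite -mulrBr -sumrB expr2 mulrACA; congr (_ * _).
  rewrite mulr_suml; apply: eq_bigr => z _.
  by rewrite mulr_sumr; apply: eq_bigr => z' _.
pose B : R := \sum_(x <- ibox m) \sum_(y <- ibox m) c x y * `|phi (x, y)|.
have -> : \sum_(w \in A) F w * ((eta w.1)%:R * (kappa%:R - (eta w.2)%:R)
       - block_avg R l eta w.1 * (kappa%:R - block_avg R l eta w.2)) =
  n^-1 ^+ 2 * \sum_(z <- ibox l) \sum_(z' <- ibox l)
    \sum_(x <- ibox m) \sum_(y <- ibox m)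
     ((F \_ A) (x, y) - (F \_ A) (x - z, y - z')) * phi (x, y).
  rewrite (fsum_restrict_ibox _ _ Am').
  pose U := \sum_(x <- ibox m) \sum_(y <- ibox m) (F \_ A) (x, y) * phi (x, y).
  pose V z z' := \sum_(x <- ibox m) \sum_(y <- ibox m)
     (F \_ A) (x - z, y - z') * phi (x, y).
  (* [U] does not depend on the shifts, hence equals its own average; the remaining term becomes the
     average of [V] after each shift is moved from [phi] to [F]. *)
  transitivity (n^-1 ^+ 2 * \sum_(z <- ibox l) \sum_(z' <- ibox l) (U - V z z'));
      last first.
    congr (_ * _); apply: eq_bigr => z _; apply: eq_bigr => z' _.
    rewrite -sumrB; apply: eq_bigr => x _; rewrite -sumrB; apply: eq_bigr => y _.
    by rewrite mulrBl.
  transitivity (U - n^-1 ^+ 2 * \sum_(z <- ibox l) \sum_(z' <- ibox l) V z z');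
      last first.
    under [in RHS]eq_bigr do rewrite sumrB.
    rewrite sumrB mulrBr; congr (_ - _).
    by rewrite !sum_n nK.
  transitivity (U - n^-1 ^+ 2 * \sum_(z <- ibox l) \sum_(z' <- ibox l)
     \sum_(x <- ibox m) \sum_(y <- ibox m)
        (F \_ A) (x, y) * phi (x + z, y + z')).
    have swap (f : int -> int -> int -> R) (r1 r2 r3 : seq int) :
        \sum_(x <- r1) \sum_(y <- r2) \sum_(z <- r3) f x y z =
        \sum_(z <- r3) \sum_(x <- r1) \sum_(y <- r2) f x y z.
      rewrite [RHS]exchange_big/=; apply: eq_bigr => x _.
      by rewrite exchange_big.
    rewrite (_ : \sum_(z <- ibox l) _ = \sum_(x <- ibox m) \sum_(y <- ibox m)
        \sum_(z <- ibox l) \sum_(z' <- ibox l)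
          (F \_ A) (x, y) * phi (x + z, y + z')); last first.
      by rewrite [RHS]swap; apply: eq_bigr => z _; rewrite [RHS]swap.
    rewrite mulr_sumr -sumrB; apply: eq_bigr => x _.
    rewrite mulr_sumr -sumrB; apply: eq_bigr => y _.
    rewrite (avgE (x, y)) mulrBr; congr (_ - _).
    rewrite mulrCA; congr (_ * _); rewrite mulr_sumr; apply: eq_bigr => z _.
    by rewrite mulr_sumr.
  congr (_ - _ * _); rewrite !big_seq; apply: eq_bigr => z.
  rewrite mem_ibox => zl; rewrite !big_seq; apply: eq_bigr => z'.
  rewrite mem_ibox => zl'.
  exact: (@shift_ibox l m A F phi (z, z')).
rewrite normrM ger0_norm ?sqr_ge0//.
apply: (@le_trans _ _ (n^-1 ^+ 2 * \sum_(z <- ibox l) \sum_(z' <- ibox l) B)).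
  rewrite ler_wpM2l ?sqr_ge0//.
  rewrite (le_trans (ler_norm_sum _ _ _))// big_seq [leRHS]big_seq ler_sum// => z.
  rewrite mem_ibox => zl.
  rewrite (le_trans (ler_norm_sum _ _ _))// big_seq [leRHS]big_seq ler_sum// => z'.
  rewrite mem_ibox => zl'.
  rewrite (le_trans (ler_norm_sum _ _ _))// ler_sum// => x _.
  rewrite (le_trans (ler_norm_sum _ _ _))// ler_sum// => y _.
  by rewrite normrM ler_wpM2r// Fc.
rewrite !sum_n nK.
have c0 x y : 0 <= c x y by apply: le_trans (Fc x y 0 0 _ _).
apply: (@le_trans _ _ (\sum_(x <- ibox m) \sum_(y <- ibox m)
    c x y * ((kappa%:R + 1) * ((eta x)%:R ^+ 2 + (eta y)%:R ^+ 2)))).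
  apply: ler_sum => x _; apply: ler_sum => y _.
  by rewrite ler_wpM2l// occupation_product_bound.
(* This is an equality: exchanging the two sums in the terms with [eta y] replaces [c x y] by
   [c y x]. *)
rewrite le_eqVlt; apply/orP; left; apply/eqP.
transitivity (\sum_(x <- ibox m) \sum_(y <- ibox m)
      (c x y * ((kappa%:R + 1) * (eta x)%:R ^+ 2)) +
   \sum_(x <- ibox m) \sum_(y <- ibox m)
      (c x y * ((kappa%:R + 1) * (eta y)%:R ^+ 2))).
  rewrite -big_split/=; apply: eq_bigr => x _.
  by rewrite -big_split/=; apply: eq_bigr => y _; rewrite -!mulrDr.
rewrite [X in _ + X]exchange_big/= -big_split/=; apply: eq_bigr => x _.
rewrite -big_split/= mulrAC mulr_sumr; apply: eq_bigr => y _.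
ring.
Qed.
End shift.

(** * Points close to the boundary of the set *)

Section strips.
Variable R : realType.

(** A point farther than [h] from both [a] and [-a] cannot cross either of them by a move of size at
    most [h]. *)
Lemma lt_norm_shift (u z a h : R) : h < `|u - a| -> h < `|u + a| -> `|z| <= h ->
  (`|u - z| < a) = (`|u| < a).
Proof.
move=> h1 h2 zh; apply/idP/idP; rewrite !ltr_norml => /andP[? ?];
  move: h1 h2 zh; rewrite !ltr_normr ler_norml => /orP[?|?] /orP[?|?] /andP[? ?];
  apply/andP; split; lra.
Qed.

Lemma gt_norm_shift (u z a h : R) : h < `|u - a| -> h < `|u + a| -> `|z| <= h ->
  (a < `|u - z|) = (a < `|u|).
Proof.
move=> h1 h2 zh; apply/idP/idP; rewrite !ltr_normr => /orP[?|?];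
  move: h1 h2 zh; rewrite !ltr_normr ler_norml => /orP[?|?] /orP[?|?] /andP[? ?];
  apply/orP; first [left; lra | right; lra | lra].
Qed.

(* The strips around the lines bounding [A_eps r e] that a shift of both
   coordinates by at most [h] may cross; such a shift moves [u - v] by at most
   [h + h]. *)
Definition strips (r e h u v : R) : nat :=
  ((`|u - r| <= h)%R + (`|u + r| <= h)%R + (`|v - r| <= h)%R + (`|v + r| <= h)%R +
  (`|u - v - e| <= h + h)%R + (`|u - v + e| <= h + h)%R +
  (`|u - v - e^-1| <= h + h)%R + (`|u - v + e^-1| <= h + h)%R)%N.

Lemma strips0_A_eps_shift (r e h u v z z' : R) : strips r e h u v = 0%N ->
  `|z| <= h -> `|z'| <= h -> A_eps r e (u - z, v - z') <-> A_eps r e (u, v).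
Proof.
move=> s0 zh zh'.
have zz : `|z - z'| <= h + h by rewrite (le_trans (ler_normB _ _))// lerD.
move: s0; rewrite /strips => /eqP; rewrite !addn_eq0 !eqb0 -!ltNge.
do 7 (move=> /andP[]); move=> h1 h2 h3 h4 h5 h6 h7 h8.
have E : u - z - (v - z') = u - v - (z - z') by ring.
split=> /A_epsP/=; rewrite ?E => -[a b c]; apply/A_epsP; rewrite /= ?E; split.
- by rewrite -(lt_norm_shift h1 h2 zh) -(lt_norm_shift h3 h4 zh').
- by rewrite -(gt_norm_shift h5 h6 zz).
- by rewrite -(lt_norm_shift h7 h8 zz).
- by rewrite (lt_norm_shift h1 h2 zh) (lt_norm_shift h3 h4 zh').
- by rewrite (gt_norm_shift h5 h6 zz).
- by rewrite (lt_norm_shift h7 h8 zz).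
Qed.

Lemma count_close_lattice (m N : nat) (a b h : R) : (0 < N)%N -> 0 <= h ->
  \sum_(x <- ibox m) (`|(x%:~R / N%:R + b : R) - a| <= h)%R%:R
  <= 2 * (h * N%:R) + 1 :> R.
Proof.
move=> N0 h0; have N0' : 0 < N%:R :> R by rewrite ltr0n.
apply: le_trans (@count_close_integers R _ ((a - b) * N%:R) (h * N%:R)
  (ibox_uniq m) _); last by rewrite mulr_ge0.
apply: ler_sum => x _.
rewrite (_ : x%:~R / N%:R + b - a = (x%:~R - (a - b) * N%:R) / N%:R).
  by rewrite normrM normfV (gtr0_norm N0') ler_pdivrMr.
by field; rewrite gt_eqF.
Qed.

(** On each lattice line, a strip of half-width [h] has at most [2hN + 1 <= 3hN] points and one of
    half-width [2h] at most [4hN + 1 <= 5hN]. With four strips of each kind and [2m + 1] lines, the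
    constant is [4 * 3 + 4 * 5 = 32]. *)
Lemma sum_strips (m N : nat) (r e h : R) : (0 < N)%N -> 1 <= h * N%:R ->
  \sum_(x <- ibox m) \sum_(y <- ibox m)
    (strips r e h (x%:~R / N%:R) (y%:~R / N%:R))%:R
  <= 32 * (2 * m + 1)%:R * (h * N%:R) :> R.
Proof.
move=> N0 hN; have N0' : 0 < N%:R :> R by rewrite ltr0n.
have h0 : 0 <= h by rewrite -(pmulr_lge0 _ N0') (le_trans _ hN).
have sum_m (a : R) : \sum_(z <- ibox m) a = (2 * m + 1)%:R * a.
  by rewrite big_const_seq count_predT size_ibox iter_addr_0 mulr_natl.
(* [bound] counts in [x] for fixed [y], [bound'] in [y] for fixed [x]; the strips that constrain [v]
   alone require the latter. *)
have bound (f : int -> int -> bool) (k : R) :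
    (forall y, \sum_(x <- ibox m) (f x y)%:R <= k * (h * N%:R) :> R) ->
    \sum_(x <- ibox m) \sum_(y <- ibox m) (f x y)%:R <=
    (2 * m + 1)%:R * (k * (h * N%:R)) :> R.
  by move=> fk; rewrite exchange_big -sum_m; apply: ler_sum => y _; exact: fk.
have bound' (f : int -> int -> bool) (k : R) :
    (forall x, \sum_(y <- ibox m) (f x y)%:R <= k * (h * N%:R) :> R) ->
    \sum_(x <- ibox m) \sum_(y <- ibox m) (f x y)%:R <=
    (2 * m + 1)%:R * (k * (h * N%:R)) :> R.
  by move=> fk; rewrite -sum_m; apply: ler_sum => y _; exact: fk.
have cx a (y : int) : \sum_(x <- ibox m) (`|(x%:~R / N%:R : R) - a| <= h)%R%:R
    <= 3 * (h * N%:R) :> R.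
  have := @count_close_lattice m N a 0 h N0 h0.
  by under eq_bigr do rewrite addr0; move=> ?; lra.
have cxy a (y : int) : \sum_(x <- ibox m)
    (`|(x%:~R / N%:R - y%:~R / N%:R : R) - a| <= h + h)%R%:R
    <= 5 * (h * N%:R) :> R.
  have := @count_close_lattice m N a (- (y%:~R / N%:R)) (h + h) N0 (addr_ge0 h0 h0).
  by rewrite mulrDl => ?; lra.
rewrite /strips; under eq_bigr do under eq_bigr do rewrite !natrD.
under eq_bigr do rewrite !big_split/=.
rewrite !big_split/=.
have b1 := bound _ 3 (cx r).
have b2 := bound _ 3 (cx (- r)).
have b3 := bound' _ 3 (cx r).
have b4 := bound' _ 3 (cx (- r)).
have b5 := bound _ 5 (cxy e).
have b6 := bound _ 5 (cxy (- e)).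
have b7 := bound _ 5 (cxy e^-1).
have b8 := bound _ 5 (cxy (- e^-1)).
move: b1 b2 b3 b4 b5 b6 b7 b8; rewrite !opprK => b1 b2 b3 b4 b5 b6 b7 b8.
lra.
Qed.

End strips.

(** * Estimate of the expectation *)

Section assembly.
Variable R : realType.

(** [S] is first replaced by its dominating sum through plain monotonicity of the integral. That sum
    is measurable, so time integral and expectation pass inside it and the second moment bound
    applies site by site. *)
Lemma expected_occupation_bound (Q : probability (path_space R) R) (T C q : R)
    (s : seq int) (a : int -> R) (S : path_space R -> R -> R) :
  0 <= q -> (forall x, 0 <= a x) ->
  (forall x, (\int[Q]_eta \int[lebesgue_measure]_(t in `[0%R, T])
     (((eta t x)%:R : R) ^+ 2)%:E <= C%:E)%E) ->
  (forall eta t, 0 <= t <= T ->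
    `|S eta t| <= \sum_(x <- s) a x * ((eta t x)%:R : R) ^+ 2) ->
  (\int[Q]_eta (q%:E * \int[lebesgue_measure]_(t in `[0%R, T]) `|S eta t|%:E)
    <= (q * ((\sum_(x <- s) a x) * C))%:E)%E.
Proof.
move=> q0 a0 QC Sa.
pose I (x : int) (eta : path_space R) : \bar R :=
  (\int[lebesgue_measure]_(t in `[0%R, T]) (((eta t x)%:R : R) ^+ 2)%:E)%E.
have I0 x eta : (0 <= I x eta)%E.
  by apply: integral_ge0 => t _; rewrite lee_fin sqr_ge0.
have mI x : measurable_fun setT (I x) by exact: measurable_sqr_coordinate_integral.
have sum0 eta : (0 <= \sum_(x <- s) (a x)%:E * I x eta)%E.
  by apply: sume_ge0 => x _; rewrite mule_ge0// lee_fin.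
apply: (@le_trans _ _
    (\int[Q]_eta (q%:E * \sum_(x <- s) ((a x)%:E * I x eta)))%E).
  apply: ge0_le_integral_nomeas => eta _.
    by rewrite mule_ge0 ?lee_fin// integral_ge0.
  rewrite lee_wpmul2l ?lee_fin//.
  rewrite (_ : (\sum_(x <- s) _)%E = (\int[lebesgue_measure]_(t in `[0%R, T])
      \sum_(x <- s) (a x)%:E * (((eta t x)%:R : R) ^+ 2)%:E)%E).
    apply: ge0_le_integral_nomeas => t; first by rewrite lee_fin.
    rewrite /= in_itv/= => tT; under eq_bigr do rewrite -EFinM.
    by rewrite sumEFin lee_fin; exact: Sa.
  rewrite ge0_integral_sum//.
  - apply: eq_bigr => x _; rewrite ge0_integralZl//.
    + by apply: measurable_funTS; exact: measurable_sqr_coordinate_time.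
    + by rewrite lee_fin.
  - move=> x; apply: measurable_funeM.
    by apply: measurable_funTS; exact: measurable_sqr_coordinate_time.
  - by move=> x t _; rewrite mule_ge0 ?lee_fin ?sqr_ge0.
have maI x : measurable_fun setT (fun eta => ((a x)%:E * I x eta)%E).
  exact: measurable_funeM.
rewrite ge0_integralZl ?lee_fin//; last exact: emeasurable_sum.
rewrite ge0_integral_sum//; last first.
  - by move=> x eta _; rewrite mule_ge0// lee_fin.
rewrite EFinM lee_wpmul2l ?lee_fin// mulr_suml -sumEFin lee_sum// => x _.
rewrite ge0_integralZl ?lee_fin//.
by rewrite EFinM lee_wpmul2l ?lee_fin//; exact: QC.
Qed.

(** If both points lie in the set, the increment is at most [om]; if neither does, it vanishes. If
    exactly one does, it is at most [M], and the shift has crossed the boundary, so at least one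
    strip contains the point. *)
Lemma increment_bound (Hf : R * R -> R) (r e M om d eps : R) (N l : nat)
    (x y z z' : int) :
  (forall w, A_eps r e w -> `|Hf w| <= M) ->
  (forall v w, A_eps r e v -> A_eps r e w ->
     `|v.1 - w.1| < d -> `|v.2 - w.2| < d -> `|Hf v - Hf w| <= om) ->
  0 <= om -> 0 <= M -> eps < d -> l%:R / N%:R <= eps ->
  (`|z| <= l)%N -> (`|z'| <= l)%N ->
  let F := (fun w : int * int => Hf (w.1%:~R / N%:R, w.2%:~R / N%:R))
             \_ (scaled N (A_eps r e)) in
  `|F (x, y) - F (x - z, y - z')| <=
  om + M * (strips r e eps (x%:~R / N%:R) (y%:~R / N%:R))%:R.
Proof.
move=> HM Hom om0 M0 epsd lN zl zl'; cbv zeta; set F := patch _ _ _.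
have small (k : int) : (`|k| <= l)%N -> `|k%:~R / N%:R : R| <= eps.
  move=> kl; apply: le_trans lN; rewrite normrM normfV normr_nat.
  by rewrite ler_wpM2r// -intr_norm -natr_absz ler_nat.
have FE w : F w = if `[< A_eps r e (w.1%:~R / N%:R, w.2%:~R / N%:R) >]
    then Hf (w.1%:~R / N%:R, w.2%:~R / N%:R) else 0 by [].
rewrite !FE /= !intrB !mulrBl.
move: (small _ zl) (small _ zl').
move: (x%:~R / _) (y%:~R / _) (z%:~R / _) (z'%:~R / _)
  => {FE F small zl zl'}u v {}z {}z' zs zs'.
have M1 : ~ (A_eps r e (u - z, v - z') <-> A_eps r e (u, v)) ->
    M <= om + M * (strips r e eps u v)%:R.
  move=> nA; apply: ler_wpDl => //; rewrite ler_peMr// ler1n lt0n.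
  by apply/eqP => s0; apply: nA; exact: strips0_A_eps_shift s0 zs zs'.
case: asboolP => [Auv|nA]; case: asboolP => [Auv'|nA'].
- apply: (@le_trans _ _ om); last by rewrite lerDl mulr_ge0.
  apply: Hom => //=; rewrite opprB addrC subrK.
    exact: le_lt_trans epsd.
  exact: le_lt_trans epsd.
- by rewrite subr0 (le_trans (HM _ Auv))// M1// => -[_ /(_ Auv)].
- by rewrite sub0r normrN (le_trans (HM _ Auv'))// M1// => -[/(_ Auv')].
- by rewrite subrr normr0 addr_ge0// mulr_ge0.
Qed.

(** Since [2m + 1 <= 3bN], the constant part sums to at most [9 b^2 om N^2] and the strips to at
    most [M * 32 * 3bN * eps N]. The factor 2 comes from the symmetrized weight. *)
Lemma sum_weights (om M r e eps b : R) (N m kappa : nat) :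
  let c x y := om + M * (strips r e eps (x%:~R / N%:R) (y%:~R / N%:R))%:R in
  (0 < N)%N -> 1 <= eps * N%:R -> 1 <= b -> m%:R <= b * N%:R ->
  0 <= om -> 0 <= M ->
  (N%:R ^+ 2)^-1 * \sum_(x <- ibox m) ((kappa%:R + 1) *
     \sum_(y <- ibox m) (c x y + c y x)) <=
  2 * (kappa%:R + 1) * (9 * b ^+ 2 * om + 96 * b * M * eps).
Proof.
move=> c N0 epsN b1 mb om0 M0.
have N0' : 1 <= N%:R :> R by rewrite ler1n.
rewrite -mulr_sumr.
have -> : \sum_(x <- ibox m) \sum_(y <- ibox m) (c x y + c y x) =
    2 * \sum_(x <- ibox m) \sum_(y <- ibox m) c x y.
  rewrite (eq_bigr (fun x => \sum_(y <- ibox m) c x y + \sum_(y <- ibox m) c y x)).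
    by rewrite big_split/= [X in _ + X]exchange_big/= mulr_natl mulr2n.
  by move=> x _; rewrite big_split.
have sum_m (a : R) : \sum_(z <- ibox m) a = (2 * m + 1)%:R * a.
  by rewrite big_const_seq count_predT size_ibox iter_addr_0 mulr_natl.
have -> : \sum_(x <- ibox m) \sum_(y <- ibox m) c x y =
    (2 * m + 1)%:R * ((2 * m + 1)%:R * om) +
    M * \sum_(x <- ibox m) \sum_(y <- ibox m)
      (strips r e eps (x%:~R / N%:R) (y%:~R / N%:R))%:R.
  rewrite -!sum_m mulr_sumr -big_split/=; apply: eq_bigr => x _.
  by rewrite mulr_sumr -big_split/=; apply: eq_bigr => y _.
have := @sum_strips R m N r e eps N0 epsN.
move: (\sum_(x <- ibox m) _) => st sth.
have m3 : (2 * m + 1)%:R <= 3 * b * N%:R :> R.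
  rewrite natrD natrM.
  have : 1 <= b * N%:R by rewrite mulr_ege1.
  lra.
have m0 : 0 <= (2 * m + 1)%:R :> R by [].
move: ((2 * m + 1)%:R : R) m0 m3 sth => n n0 n3 sth.
have k0 : 0 <= kappa%:R + 1 :> R by rewrite addr_ge0.
rewrite mulrC ler_pdivrMr; last by rewrite exprn_gt0// (lt_le_trans _ N0').
rewrite (_ : 2 * _ * _ * _ = (kappa%:R + 1) * (2 *
   ((9 * b ^+ 2 * om + 96 * b * M * eps) * N%:R ^+ 2))); last by ring.
rewrite ler_wpM2l// ler_wpM2l// mulrDl lerD//.
  have : n * n <= (3 * b * N%:R) * (3 * b * N%:R) by rewrite ler_pM.
  move=> /(ler_wpM2r om0) h; lra.
apply: (@le_trans _ _ (M * (32 * (3 * b * N%:R) * (eps * N%:R)))).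
  rewrite ler_wpM2l// (le_trans sth)// ler_wpM2r//; first by lra.
  by rewrite ler_wpM2l.
by rewrite le_eqVlt; apply/orP; left; apply/eqP; ring.
Qed.

End assembly.

(** * Choice of the scales and passage to the limit *)

Theorem lemma3p10 (R : realType) (kappa : nat) (gamma : R) (p : R -> R -> R)
    (G : R -> R -> R) (T : R) (P : nat -> probability (path_space R) R)
    (hkappa : (0 < kappa)%N)
    (hp : kernel_assumptions gamma p)
    (hG : test_function G)
    (hT : 0 < T)
    (hGT : supp G `<=` [set z | z.1 < T])
    (hP : forall T' : R, 0 < T' ->
      (limn_esup (fun N : nat =>
         ereal_sup [set \int[P N]_eta \int[lebesgue_measure]_(t in `[0%R, T'])
                          (((eta t x)%:R : R) ^+ 2)%:E | x in @setT int])
       < +oo)%E)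
    (r eps' : R) (hr : 0 < r) (heps' : 0 < eps') :
  limf_esup (fun eps : R => limn_esup (fun N : nat =>
    (\int[P N]_eta ((N%:R ^+ 2)^-1%:E *
       \int[lebesgue_measure]_(t in `[0%R, T])
         `| \sum_(z \in scaled N (A_eps r eps'))
              H_ p G t (z.1%:~R / N%:R) (z.2%:~R / N%:R) *
              (let l := Num.truncn (eps * N%:R) in
               (eta t z.1)%:R * (kappa%:R - (eta t z.2)%:R)
               - block_avg R l (eta t) z.1
                 * (kappa%:R - block_avg R l (eta t) z.2)) |%:E))%E)) 0^'+
  = 0%E.
Proof.
have [C C0 [N0 _ CP]] := limn_esup_fin_bound (hP T hT).
have [[M M0 HM] Hom] := H_bounded_unif_continuous T r hp hG heps'.
(* Points of [A_eps r eps'] have coordinates at most [r + eps'^-1]; the extra 1 leaves room in the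
   box for shifts of size [eps N <= N]. *)
pose b := r + eps'^-1 + 1.
have b1 : 1 <= b by rewrite /b lerDr addr_ge0// ltW// invr_gt0.
apply/eqP; rewrite eq_le; apply/andP; split; last first.
  apply: limf_esup_ge0 => [|eps].
    by move=> /(@filter_not_empty _ 0^'+).
  apply: limf_esup_ge0 => [|N]; first by move=> /(@filter_not_empty _ \oo).
  apply: integral_ge0 => eta _; rewrite mule_ge0 ?lee_fin ?invr_ge0 ?exprn_ge0//.
  by apply: integral_ge0 => t _; rewrite lee_fin.
apply/lee_addgt0Pr => dl dl0; rewrite add0e.
pose k := 2 * (kappa%:R + 1) * C.
have k0 : 0 <= k by rewrite /k !mulr_ge0// addr_ge0.
have b0 : 0 <= b by apply: le_trans b1.
(* [om] and, below, [eps0] make each of the two terms of [sum_weights], multiplied by [C], at most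
   [dl / 2]; the added 1 keeps the denominators positive. *)
pose om := dl / (2 * (k * (9 * b ^+ 2) + 1)).
have om0 : 0 < om.
  by rewrite divr_gt0// mulr_gt0// ltr_wpDl// !mulr_ge0// exprn_ge0.
have [d d0 HH] := Hom om om0.
pose eps0 := dl / (2 * (k * (96 * b * M) + 1)).
have eps00 : 0 < eps0.
  by rewrite divr_gt0// mulr_gt0// ltr_wpDl// !mulr_ge0.
apply: limf_esup_le_near.
near=> eps.
have eps_gt0 : 0 < eps by near: eps; exact: nbhs_right_gt.
have eps1 : eps <= 1 by near: eps; exact: nbhs_right_le.
have epsd : eps < d by near: eps; exact: nbhs_right_lt.
have epse : eps <= eps0 by near: eps; exact: nbhs_right_le.
rewrite /limn_esup; apply: limf_esup_le_near.
near=> N.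
have Ngt0 : (0 < N)%N by near: N; exists 1%N.
have NN0 : (N0 <= N)%N by near: N; exists N0.
(* With [N >= 1 / eps] the additive 1 in the lattice counts is absorbed by [eps N]. *)
have epsN : 1 <= eps * N%:R.
  rewrite mulrC -ler_pdivrMr// mul1r.
  by near: N; exact: nbhs_infty_ger.
have N0' : 0 < N%:R :> R by rewrite ltr0n.
pose l := Num.truncn (eps * N%:R); pose m := Num.truncn (b * N%:R).
have lN : l%:R / N%:R <= eps.
  by rewrite ler_pdivrMr// truncn_le mulr_ge0// ltW.
have mN : m%:R <= b * N%:R by rewrite truncn_le; exact: mulr_ge0.
pose c x y := om + M * (strips r eps' eps (x%:~R / N%:R) (y%:~R / N%:R))%:R.
have c0 x y : 0 <= c x y by apply: addr_ge0; [exact: ltW|exact: mulr_ge0].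
have inbox w : scaled N (A_eps r eps') w ->
    (`|w.1| + l <= m)%N /\ (`|w.2| + l <= m)%N.
  have aux (x : int) : `|x%:~R / N%:R : R| <= r + eps'^-1 -> (`|x| + l <= m)%N.
    rewrite normrM normfV (gtr0_norm N0') ler_pdivrMr// => xN.
    rewrite truncn_ge_nat ?mulr_ge0// natrD natr_absz intr_norm /b mulrDl mul1r.
    by rewrite lerD// (le_trans _ (ler_piMl (ltW N0') eps1))// -ler_pdivrMr.
  by move=> /A_eps_bounded[/= /aux ? /aux ?].
have CP' x : (\int[P N]_eta \int[lebesgue_measure]_(t in `[0%R, T])
     (((eta t x)%:R : R) ^+ 2)%:E <= C%:E)%E.
  by apply: le_trans (CP N NN0); apply: ereal_sup_ubound; exists x.
apply: le_trans (expected_occupation_bound (s := ibox m)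
  (a := fun x => (kappa%:R + 1) * \sum_(y <- ibox m) (c x y + c y x)) _ _ CP' _) _.
- by rewrite invr_ge0 exprn_ge0.
- by move=> x; rewrite mulr_ge0 ?addr_ge0// sumr_ge0// => y _; rewrite addr_ge0.
- move=> eta t tT /=.
  apply: (@block_replacement_bound R kappa l m (scaled N (A_eps r eps'))
    (fun z => H_ p G t (z.1%:~R / N%:R) (z.2%:~R / N%:R)) (eta t) c) => //.
  move=> x y z z' zl zl'.
  apply: (@increment_bound R (fun w => H_ p G t w.1 w.2) r eps' M om d eps N l) => //.
  + by move=> w Aw; exact: HM.
  + by move=> v w Av Aw; exact: HH.
  + exact: ltW.
rewrite lee_fin mulrA.
have := @sum_weights R om M r eps' eps b N m kappa Ngt0 epsN b1 mN (ltW om0) M0.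
move=> /(ler_wpM2r C0) /le_trans; apply.
have h1 : k * (9 * b ^+ 2) * om <= dl / 2.
  rewrite /om; have : 0 <= k * (9 * b ^+ 2) by rewrite !mulr_ge0// exprn_ge0.
  move: (k * (9 * b ^+ 2)) => q q0.
  rewrite mulrA ler_pdivrMr; last by lra.
  nra.
have h2 : k * (96 * b * M) * eps <= dl / 2.
  have : 0 <= k * (96 * b * M) by rewrite !mulr_ge0.
  rewrite /eps0 in epse; move: (k * (96 * b * M)) epse => q qe q0.
  apply: (le_trans (ler_wpM2l q0 qe)); rewrite mulrA ler_pdivrMr; last by lra.
  nra.
rewrite (_ : _ * C = k * (9 * b ^+ 2) * om + k * (96 * b * M) * eps); last first.
  by rewrite /k; ring.
by rewrite (splitr dl) lerD.
Unshelve. all: by end_near. Qed.
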